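(* Let $F:\mathbb{R}^n\to\mathbb{R}^m$, let $D\subset\mathbb{R}^m$ be closed, let $\Omega=\{x\in\mathbb{R}^n\mid F(x)\in D\}$, let $\bar x\in\Omega$, let $F$ be continuously differentiable at $\bar x$, and assume that GGCQ holds at $\bar x$. Let $Q_1$ and $Q_2$ be two closed convex cones contained in $T_D(F(\bar x))$. If $$(\nabla F(\bar x)^{-1}Q_i)^\circ=\nabla F(\bar x)^TQ_i^\circ,\quad i=1,2,$$ then $$\widehat N_\Omega(\bar x)\subset \nabla F(\bar x)^T\left(Q_1^\circ\cap(\ker\nabla F(\bar x)^T+ Q_2^\circ)\right)=(\nabla F(\bar x)^TQ_1^\circ)\cap(\nabla F(\bar x)^TQ_2^\circ).$$ Further, if $$\nabla F(\bar x)^T\left(Q_1^\circ\cap(\ker\nabla F(\bar x)^T+ Q_2^\circ)\right)\subset \nabla F(\bar x)^T\widehat N_D(F(\bar x)),$$ then the inclusion for $\widehat N_\Omega(\bar x)$ holds with equality, i.e. $\widehat N_\Omega(\bar x)= \nabla F(\bar x)^T\left(Q_1^\circ\cap(\ker\nabla F(\bar x)^T+ Q_2^\circ)\right)$.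
   Context: $K^\circ=\{z^*\mid \langle z^*,u\rangle\le 0\ \forall u\in K\}$ is the polar of $K$. For a set $\Gamma\subset\mathbb{R}^d$ and $\bar z\in\Gamma$, the tangent (contingent) cone is $T_\Gamma(\bar z)=\{u\mid \exists t_k\searrow 0,\ u_k\to u:\ \bar z+t_ku_k\in\Gamma\ \forall k\}$ and the regular normal cone is $\widehat N_\Gamma(\bar z)=(T_\Gamma(\bar z))^\circ$. $\nabla F(\bar x)$ is the Jacobian ($m\times n$ matrix), and $\nabla F(\bar x)^{-1}Q:=\{u\in\mathbb{R}^n\mid\nabla F(\bar x)u\in Q\}$ for a set $Q$. For a matrix $A$ and set $S$, $AS=\{As\mid s\in S\}$; sums of sets are Minkowski sums. The linearized cone is $T^{\rm lin}_\Omega(\bar x)=\{u\in\mathbb{R}^n\mid\nabla F(\bar x)u\in T_D(F(\bar x))\}$. GGCQ (generalized Guignard constraint qualification) holds at $\bar x$ if $(T_\Omega(\bar x))^\circ=(T^{\rm lin}_\Omega(\bar x))^\circ$. *)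

(* Defs.v *)
From mathcomp Require Import all_boot all_order all_algebra.
From mathcomp Require Import all_classical all_reals all_analysis.

Set Implicit Arguments.
Unset Strict Implicit.
Unset Printing Implicit Defensive.

Import Order.TTheory GRing.Theory Num.Theory.
Import numFieldNormedType.Exports.

Local Open Scope classical_set_scope.
Local Open Scope ring_scope.

(* A vector of R^d is a row vector 'rV[R]_d; a matrix A : 'M_(m, n) acts on
   u : 'rV_n by u *m A^T, which is the row vector of the column A u. *)

Definition dot (R : realType) (d : nat) (z u : 'rV[R]_d) : R :=
  \sum_(i < d) z 0 i * u 0 i.

Definition polar (R : realType) (d : nat) (K : set 'rV[R]_d) : set 'rV[R]_d :=
  [set z | forall u, K u -> dot z u <= 0].

Definition mximage (R : realType) (m n : nat) (A : 'M[R]_(m, n))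
    (S : set 'rV[R]_n) : set 'rV[R]_m :=
  [set s *m A^T | s in S].

Definition mxpreimage (R : realType) (m n : nat) (A : 'M[R]_(m, n))
    (Q : set 'rV[R]_m) : set 'rV[R]_n :=
  [set u | Q (u *m A^T)].

Definition mxker (R : realType) (m n : nat) (A : 'M[R]_(m, n)) :
    set 'rV[R]_n :=
  [set u | u *m A^T = 0].

Definition minkowski_sum (R : realType) (d : nat) (A B : set 'rV[R]_d) :
    set 'rV[R]_d :=
  [set a + b | a in A & b in B].

Definition cone (R : realType) (d : nat) (K : set 'rV[R]_d) : Prop :=
  K 0 /\ forall (t : R) u, 0 < t -> K u -> K (t *: u).

Definition closed_convex_cone (R : realType) (d : nat) (K : set 'rV[R]_d) :
    Prop :=
  [/\ closed K, convex_set K & cone K].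

(* t_k \searrow 0 means t_k > 0 and t_k --> 0; monotonicity is not required. *)
Definition tangent_cone (R : realType) (d : nat) (G : set 'rV[R]_d)
    (z : 'rV[R]_d) : set 'rV[R]_d :=
  [set u | exists (t : nat -> R) (v : nat -> 'rV[R]_d),
    [/\ forall k, 0 < t k, t @ \oo --> (0 : R), v @ \oo --> u &
        forall k, G (z + t k *: v k)]].

Definition regular_normal_cone (R : realType) (d : nat) (G : set 'rV[R]_d)
    (z : 'rV[R]_d) : set 'rV[R]_d :=
  polar (tangent_cone G z).

(* 'J F x satisfies 'd F x u = u *m 'J F x, so it is the transpose of the
   usual m x n matrix of partial derivatives. *)
Definition nabla (R : realType) (n m : nat) (F : 'rV[R]_n -> 'rV[R]_m)
    (x : 'rV[R]_n) : 'M[R]_(m, n) :=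
  ('J F x)^T.

Definition continuously_differentiable_at (R : realType) (n m : nat)
    (F : 'rV[R]_n -> 'rV[R]_m) (x : 'rV[R]_n) : Prop :=
  (\forall y \near x, differentiable F y) /\
  {for x, continuous (nabla F)}.

Definition linearized_cone (R : realType) (n m : nat)
    (F : 'rV[R]_n -> 'rV[R]_m) (D : set 'rV[R]_m) (x : 'rV[R]_n) :
    set 'rV[R]_n :=
  mxpreimage (nabla F x) (tangent_cone D (F x)).

Definition GGCQ (R : realType) (n m : nat)
    (F : 'rV[R]_n -> 'rV[R]_m) (D : set 'rV[R]_m) (x : 'rV[R]_n) : Prop :=
  polar (tangent_cone (F @^-1` D) x) = polar (linearized_cone F D x).

(* Main.v *)
Require Import Defs.
From mathcomp Require Import all_boot all_order all_algebra.
From mathcomp Require Import all_classical all_reals all_analysis.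
Import Order.TTheory GRing.Theory Num.Theory.
Import numFieldNormedType.Exports.
Local Open Scope classical_set_scope.
Local Open Scope ring_scope.

(** Write [A] for the Jacobian.  Polarity reverses inclusions.  Since each
    [Q_i] lies in [T_D(F(xbar))], its preimage under [A] lies in the linearized
    cone, so the polar of the linearized cone, which GGCQ identifies with the
    regular normal cone of [Omega], lies in both polars of the preimages, that
    is, in [A^T Q_1^o] and in [A^T Q_2^o].

    The intersection of these two images is the image of a single set because
    [A^T s = A^T q] means that [s] belongs to [ker A^T + q]
    ([mximage_setI_ker]).

    For the reverse inclusion, [A^T] is the adjoint of [A], so it maps the polar
    of a set into the polar of its preimage ([mximage_polar_sub]).  For the
    tangent cone of [D] this gives that [A^T N_D(F(xbar))] is contained in the
    polar of the linearized cone, hence, by GGCQ again, in the regular normal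
    cone of [Omega]. *)

Lemma polarS (R : realType) (d : nat) (K L : set 'rV[R]_d) :
  K `<=` L -> polar L `<=` polar K.
Proof. by move=> KL z Lz u /KL; exact: Lz. Qed.

Lemma mxpreimageS (R : realType) (m n : nat) (A : 'M[R]_(m, n))
    (P Q : set 'rV[R]_m) :
  P `<=` Q -> mxpreimage A P `<=` mxpreimage A Q.
Proof. by move=> PQ u; exact: PQ. Qed.

Lemma dotE (R : realType) (d : nat) (z u : 'rV[R]_d) :
  dot z u = (z *m u^T) 0 0.
Proof. by rewrite mxE; apply: eq_bigr => i _; rewrite mxE. Qed.

Lemma dot_adjoint (R : realType) (m n : nat) (A : 'M[R]_(m, n))
    (z : 'rV[R]_m) (u : 'rV[R]_n) :
  dot (z *m A^T^T) u = dot z (u *m A^T).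
Proof. by rewrite !dotE trmx_mul mulmxA. Qed.

(** The elementary half of the calculus rule for the polar of a linear
    preimage, a consequence of adjointness alone.  The opposite inclusion, a
    form of the Farkas lemma, fails for general [Q]. *)
Lemma mximage_polar_sub (R : realType) (m n : nat) (A : 'M[R]_(m, n))
    (Q : set 'rV[R]_m) :
  mximage A^T (polar Q) `<=` polar (mxpreimage A Q).
Proof. by move=> _ [z Qz <-] u Qu; rewrite dot_adjoint; exact: Qz. Qed.

(** Two points have the same image under [B] exactly when they differ by an
    element of the kernel, so enlarging one of the sets by the kernel lets the
    image commute with the intersection. *)
Lemma mximage_setI_ker (R : realType) (m n : nat) (B : 'M[R]_(m, n))
    (S T : set 'rV[R]_n) :
  mximage B (S `&` minkowski_sum (mxker B) T) = mximage B S `&` mximage B T.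
Proof.
apply/seteqP; split=> [_ [s [Ss [k Bk [t Tt kts]]] <-]|_ [[s Ss <-] [t Tt Bts]]].
  split; first by exists s.
  by exists t => //; rewrite -kts mulmxDl Bk add0r.
exists s => //; split=> //; exists (s - t).
  by rewrite /mxker /= mulmxBl Bts subrr.
by exists t => //; rewrite subrK.
Qed.

Theorem theorem2 (R : realType) (n m : nat) (F : 'rV[R]_n -> 'rV[R]_m)
    (D : set 'rV[R]_m) (Omega : set 'rV[R]_n) (xbar : 'rV[R]_n)
    (Q1 Q2 : set 'rV[R]_m)
    (hD : closed D)
    (hOmega : Omega = [set x | D (F x)])
    (hxbar : Omega xbar)
    (hF : continuously_differentiable_at F xbar)
    (hGGCQ : GGCQ F D xbar)
    (hQ1 : closed_convex_cone Q1)
    (hQ2 : closed_convex_cone Q2)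
    (hQ1T : Q1 `<=` tangent_cone D (F xbar))
    (hQ2T : Q2 `<=` tangent_cone D (F xbar))
    (hQ1polar : polar (mxpreimage (nabla F xbar) Q1) =
                mximage (nabla F xbar)^T (polar Q1))
    (hQ2polar : polar (mxpreimage (nabla F xbar) Q2) =
                mximage (nabla F xbar)^T (polar Q2)) :
  let A := nabla F xbar in
  let U := mximage A^T
             (polar Q1 `&` minkowski_sum (mxker A^T) (polar Q2)) in
  [/\ regular_normal_cone Omega xbar `<=` U,
      U = mximage A^T (polar Q1) `&` mximage A^T (polar Q2) &
      U `<=` mximage A^T (regular_normal_cone D (F xbar)) ->
      regular_normal_cone Omega xbar = U].
Proof.
move=> A U.
have UE : U = mximage A^T (polar Q1) `&` mximage A^T (polar Q2).
  exact: mximage_setI_ker.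
have NE : regular_normal_cone Omega xbar = polar (linearized_cone F D xbar).
  by rewrite hOmega; exact: hGGCQ.
have NU : regular_normal_cone Omega xbar `<=` U.
  rewrite UE NE -hQ1polar -hQ2polar subsetI.
  by split; apply: polarS; exact: mxpreimageS.
split=> // UN; apply/seteqP; split=> //.
by rewrite NE; apply: subset_trans UN _; exact: mximage_polar_sub.
Qed.
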